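(* Let $d\ge1$, $1\le n\le N\le\infty$ with $n$ finite, and let $\{\xi(i,m)\}$, $n\le i\le N$ ($i$ finite), $m=1,\dots,d$, be centered reverse martingale differences relative to one common reverse filtration $\{F(i)\}$, such that the random vectors $\vec\xi(m)=\{\xi(i,m)\}_i$, $m=1,\dots,d$, are independent. Put $\nu_m^{(n)}(p)=\sup_{n\le i\le N}|\xi(i,m)|_p$ and assume that, for each $m$, $\nu_m^{(n)}\in G(\nu,r_m)$ for some $2<r_m\le\infty$. Define for $p\ge2$, by reverse recursion, $$\zeta_d(p)=K_M(p)\,\nu_d^{(n)}(p),\qquad \zeta_m(p)=K_M(p)\,\zeta_{m+1}(p)\,\nu_m^{(n)}(p),\quad m=d-1,d-2,\dots,1,$$ that is, $\zeta_1(p)=K_M^d(p)\prod_{m=1}^d\nu_m^{(n)}(p)$. Then $$\sup_{b\in B}\|V_n^{(N)}(d,b)\|G(\zeta_1)\ \le\ \prod_{m=1}^d\|\vec\xi(m)\|G(\nu_m^{(n)},r_m),$$ where, with $s=\min_m r_m$, $\|V\|G(\zeta_1)=\sup_{p\in(2,s)}|V|_p/\zeta_1(p)$ and $\|\vec\xi(m)\|G(\nu_m^{(n)},r_m)=\sup_{p\in(2,r_m)}\sup_{n\le i\le N}|\xi(i,m)|_p/\nu_m^{(n)}(p)$.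
   Context: All random variables live on a probability space $(\Omega,F,\mathbf P)$; $|\xi|_p=(\mathbf E|\xi|^p)^{1/p}$. Suprema of nonnegative quantities over the empty set are $0$. Reverse martingale differences: $F(i+1)\subset F(i)\subset F$; each $\xi(i,m)$ is $F(i)$-measurable, $\mathbf E\xi(i,m)=0$, and $\mathbf E[\xi(i,m)\mid F(k)]=0$ a.s. for all $k=i+1,i+2,\dots$. The reverse filtration is the same for all $m=1,\dots,d$. Polynomial: $I_n^{(N)}(d)=\{(i_1,\dots,i_d):n\le i_1<i_2<\dots<i_d\le N\}$ (finite indices); for a real non-random array $b=(b(I))$ indexed by $I_n^{(N)}(d)$, $$V_n^{(N)}(d,b)=\sum_{I=(i_1,\dots,i_d)\in I_n^{(N)}(d)}b(I)\prod_{m=1}^d\xi(i_m,m).$$ For $N=\infty$ the sum is understood as the limit as $N\to\infty$ of the sums for finite $N$, for those $b$ for which this limit exists with probability one. $B=\{b:\sum_{I\in I_n^{(N)}(d)}b^2(I)=1\}$. Class $G(\nu,r)$ ($2<r\le\infty$): functions $\nu$ that are continuous, positive and finite on $[1,r)$, with $\inf_{p\in(2,r)}\nu(p)>0$ and $\nu(p)=\infty$ for $p>r$. Constant $K_M(p)$, $p\ge2$: the smallest constant $K$ such that for every finite $n$, every sequence $\theta(1),\dots,\theta(n)$ of centered martingale differences relative to some filtration, and all real $b(1),\dots,b(n)$ with $\sum_i b^2(i)=1$, one has $\left|\sum_{i=1}^n b(i)\theta(i)\right|_p\le K\sup_i|\theta(i)|_p$. (It is known that $K_M(p)\le p\sqrt2$.)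 *)

(* Defs.v *)
From HB Require Import structures.
From mathcomp Require Import all_boot all_order all_algebra.
From mathcomp Require Import all_classical all_reals all_analysis.

Set Implicit Arguments.
Unset Strict Implicit.
Unset Printing Implicit Defensive.

Import Order.TTheory GRing.Theory Num.Theory.
Import numFieldNormedType.Exports.

Local Open Scope classical_set_scope.
Local Open Scope ring_scope.

(* Supremum of a set of nonnegative extended reals; it is 0 on the empty set,
   where [ereal_sup] would give -oo. *)
Definition nnsup (R : realType) (A : set (\bar R)) : \bar R :=
  ereal_sup (0%E |` A).

Section sub_sigma_algebras.
Context (R : realType) (disp : measure_display) (T : measurableType disp)
  (P : probability T R).

Definition sub_sigma_field (G : set (set T)) : Prop :=
  sigma_algebra setT G /\ G `<=` measurable.

Definition measurable_wrt (G : set (set T)) (X : T -> R) : Prop :=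
  forall B : set R, measurable B -> G (X @^-1` B).

Definition centered (X : T -> R) : Prop :=
  P.-integrable setT (EFin \o X) /\ ('E_P[X] = 0)%E.

(* [Y] is a version of E[X | G]. *)
Definition is_cond_expectation (G : set (set T)) (X Y : T -> R) : Prop :=
  [/\ P.-integrable setT (EFin \o X),
      P.-integrable setT (EFin \o Y),
      measurable_wrt G Y &
      forall A, G A ->
        (\int[P]_(w in A) (Y w)%:E = \int[P]_(w in A) (X w)%:E)%E].

(* Mutual independence of a finite family of classes of events. *)
Definition independent_classes (I : finType) (S : I -> set (set T)) : Prop :=
  forall (J : {set I}) (A : I -> set T),
    (forall m, m \in J -> S m (A m)) ->
    (P (\bigcap_(m in [set` J]) A m) = \prod_(m in J) P (A m))%E.

(* [theta 0, ..., theta (k - 1)] are centered martingale differences relative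
   to the filtration [F 0, ..., F (k - 1)]. *)
Definition martingale_differences (k : nat) (F : nat -> set (set T))
    (theta : nat -> T -> R) : Prop :=
  [/\ forall i, (i < k)%N -> sub_sigma_field (F i),
      forall i, (i.+1 < k)%N -> F i `<=` F i.+1,
      forall i, (i < k)%N -> measurable_wrt (F i) (theta i),
      forall i, (i < k)%N -> centered (theta i) &
      forall i j, (j < i)%N -> (i < k)%N ->
        is_cond_expectation (F j) (theta i) (cst 0)].

End sub_sigma_algebras.

(* Admissible constants K in the definition of K_M(p); K depends on p only, so
   the probability space is arbitrary. *)
Definition KM_admissible (R : realType) (p K : R) : Prop :=
  forall (disp : measure_display) (T : measurableType disp)
    (P : probability T R) (k : nat) (F : nat -> set (set T))
    (theta : nat -> T -> R) (b : nat -> R),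
    martingale_differences P k F theta ->
    \sum_(i < k) b i ^+ 2 = 1 ->
    ('N[P]_(p%:E)[EFin \o (fun w => \sum_(i < k) b i * theta i w)%R] <=
     K%:E * nnsup [set 'N[P]_(p%:E)[EFin \o theta i] | i in `I_k])%E.

(* The infimum is taken in \bar R: it would be +oo, and not a junk real number,
   if no constant were admissible. *)
Definition KM (R : realType) (p : R) : \bar R :=
  ereal_inf [set K%:E | K in [set K : R | KM_admissible p K]].

(* The upper index bound N <= oo; [None] stands for N = oo. *)
Definition index_range (n : nat) (N : option nat) : set nat :=
  [set i | (n <= i)%N && (if N is Some N' then (i <= N')%N else true)].

Definition multi_indices (d n : nat) (N : option nat) : set (d.-tuple nat) :=
  [set I : d.-tuple nat | sorted ltn I /\ forall m : 'I_d, index_range n N (tnth I m)].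
Arguments multi_indices : clear implicits.

Section random_polynomials.
Context (R : realType) (disp : measure_display) (T : measurableType disp)
  (P : probability T R) (d : nat).
Implicit Types (n : nat) (N : option nat) (xi : nat -> 'I_d -> T -> R)
  (b : d.-tuple nat -> R) (nu : R -> \bar R) (r s p : R).

Definition reverse_martingale_differences n N (F : nat -> set (set T))
    (x : nat -> T -> R) : Prop :=
  let D := index_range n N in
  [/\ forall i, D i -> sub_sigma_field (F i),
      forall i, D i -> D i.+1 -> F i.+1 `<=` F i,
      forall i, D i -> measurable_wrt (F i) (x i),
      forall i, D i -> centered P (x i) &
      forall i k, D i -> D k -> (i < k)%N ->
        is_cond_expectation P (F k) (x i) (cst 0)].

(* The sigma-algebra generated by the random vector (x i)_{n <= i <= N}. *)
Definition vector_sigma_algebra n N (x : nat -> T -> R) : set (set T) :=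
  <<s \bigcup_(i in index_range n N)
        preimage_set_system setT (x i) measurable >>.

Definition sup_Lnorm n N (x : nat -> T -> R) p : \bar R :=
  nnsup [set 'N[P]_(p%:E)[EFin \o x i]%E | i in index_range n N].

Definition rpoly_fin n (N : nat) xi b (w : T) : R :=
  \sum_(I \in multi_indices d n (Some N)) b I * \prod_(m < d) xi (tnth I m) m w.

(* For N = oo this is the limit of the finite polynomials; it is used only for
   those b for which [rpoly_defined] holds. *)
Definition rpoly n N xi b (w : T) : R :=
  if N is Some N' then rpoly_fin n N' xi b w
  else limn (fun N' : nat => rpoly_fin n N' xi b w).

Definition rpoly_defined n N xi b : Prop :=
  if N is Some _ then True
  else {ae P, forall w, cvgn (fun N' : nat => rpoly_fin n N' xi b w)}.

Definition unit_arrays n N : set (d.-tuple nat -> R) :=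
  [set b | (\esum_(I in multi_indices d n N) ((b I) ^+ 2)%:E = 1)%E].

Definition class_G (r : \bar R) nu : Prop :=
  let D := [set p : R | 1 <= p /\ (p%:E < r)%E] in
  [/\ (2%:E < r)%E,
      {within D, continuous nu},
      forall p, D p -> (0 < nu p < +oo)%E,
      (0 < ereal_inf [set nu p | p in [set p : R | (2 < p)%R /\ p%:E < r]])%E &
      forall p : R, (r < p%:E)%E -> nu p = +oo%E].

(* For nus = [:: nu_m; ...; nu_d] this is zeta_m; the value 1 on the empty list
   gives zeta_d = K_M nu_d. *)
Fixpoint zeta (nus : seq (R -> \bar R)) p : \bar R :=
  if nus is nu :: nus' then (KM p * zeta nus' p * nu p)%E else 1%E.

Definition G_norm (s : \bar R) nu (X : T -> R) : \bar R :=
  nnsup [set ('N[P]_(p%:E)[EFin \o X] / nu p)%E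
        | p in [set p : R | 2 < p /\ (p%:E < s)%E]].

Definition vector_G_norm n N (r : \bar R) nu (x : nat -> T -> R) : \bar R :=
  nnsup [set nnsup [set ('N[P]_(p%:E)[EFin \o x i] / nu p)%E
                   | i in index_range n N]
        | p in [set p : R | 2 < p /\ (p%:E < r)%E]].

End random_polynomials.

(* Main.v *)
(* Summing over the smallest index first, V(d, b) = sum_i xi(i, 1) W(i), where
   W(i) is a polynomial of degree d - 1 in the xi(j, m), j > i, m >= 2.  As
   W(i) is F(i + 1)-measurable, the products xi(i, 1) W(i) are again reverse
   martingale differences, and by independence |xi(i, 1) W(i)|_p =
   |xi(i, 1)|_p |W(i)|_p.  Reading the indices backwards turns them into
   martingale differences, so that K_M(p) applies with the weights
   beta(i) = (sum_J b(i, J)^2)^(1/2), and |W(i)|_p <= zeta_2(p) beta(i) by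
   induction on d.  The case N = oo follows by Fatou's lemma.  This gives
   |V|_p <= zeta_1(p), i.e. the left-hand side is at most 1, whereas each
   factor of the right-hand side is at least 1 because nu_m is the natural
   function of xi(., m).  If the infimum defining K_M(p) were +oo, then
   zeta_1(p) = +oo and the quotient is 0. *)
Require Import Defs.
From HB Require Import structures.
From mathcomp Require Import all_boot all_order all_algebra.
From mathcomp Require Import all_classical all_reals all_analysis.
From mathcomp Require Import measurable_realfun zify.

Import Order.TTheory GRing.Theory Num.Theory.
Import numFieldNormedType.Exports.

Local Open Scope classical_set_scope.
Local Open Scope ring_scope.

Set Implicit Arguments.
Unset Strict Implicit.
Unset Printing Implicit Defensive.

(** * Conditional expectation *)

Section measurable_wrt.
Context (R : realType) (disp : measure_display) (T : measurableType disp).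
Implicit Types (G H : set (set T)) (X Y : T -> R).

(** A sigma-algebra [G] generates nothing beyond itself, so the closure properties of measurable
    functions carry over to [measurable_wrt G]. *)
Lemma measurable_wrtP G X : sigma_algebra setT G ->
  measurable_wrt G X <->
  measurable_fun setT (X : g_sigma_algebraType G -> R).
Proof.
move=> sG; split=> [mX _ B mB|mX B mB].
  by rewrite setTI; apply: sub_sigma_algebra; exact: mX.
have := mX measurableT B mB.
by rewrite setTI /measurable/= sigma_algebra_id.
Qed.

Lemma measurable_wrt_sub G H X : G `<=` H -> measurable_wrt G X ->
  measurable_wrt H X.
Proof. by move=> GH mX B /mX /GH. Qed.

Lemma measurable_wrt_measurable G X : G `<=` measurable -> measurable_wrt G X ->
  measurable_fun setT X.
Proof. by move=> GH mX _ B mB; rewrite setTI; apply/GH/mX. Qed.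

Lemma measurable_wrt_cst G c : sigma_algebra setT G ->
  measurable_wrt G (cst c : T -> R).
Proof. by move=> sG; apply/measurable_wrtP. Qed.

Lemma measurable_wrtM G X Y : sigma_algebra setT G ->
  measurable_wrt G X -> measurable_wrt G Y -> measurable_wrt G (fun w => X w * Y w).
Proof.
move=> sG /(measurable_wrtP _ sG) mX /(measurable_wrtP _ sG) mY.
by apply/measurable_wrtP => //; exact: measurable_funM.
Qed.

Lemma measurable_wrt_sum G (I : Type) (s : seq I) (Q : pred I) (X : I -> T -> R) :
  sigma_algebra setT G ->
  (forall i, Q i -> measurable_wrt G (X i)) ->
  measurable_wrt G (fun w => \sum_(i <- s | Q i) X i w).
Proof.
move=> sG mX; elim: s => [|i s IH].
  rewrite (_ : (fun _ => _) = cst 0); first exact: measurable_wrt_cst.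
  by apply/funext => w; rewrite big_nil.
under eq_fun do rewrite big_cons.
have [Qi|_] := boolP (Q i); last exact: IH.
move: (mX i Qi) IH => /(measurable_wrtP _ sG) mXi /(measurable_wrtP _ sG) IH.
by apply/measurable_wrtP => //; exact: measurable_funD.
Qed.

Lemma measurable_wrt_indic G A : sigma_algebra setT G -> G A ->
  measurable_wrt G (\1_A : T -> R).
Proof.
move=> sG GA; apply/measurable_wrtP => //.
by apply: measurable_indic; exact: sub_sigma_algebra.
Qed.
End measurable_wrt.

(** * Products with a factor measurable for the conditioning field *)

Section zero_conditional_expectation.
Context (R : realType) (disp : measure_display) (T : measurableType disp)
  (P : probability T R).
Implicit Types (G H : set (set T)) (X Y : T -> R).
Import HBNNSimple.

(** [Y] is the increasing limit of simple functions whose level sets lie in [G]. Against these the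
    integral vanishes term by term; dominated convergence, with dominant [|X Y|], passes to the
    limit. *)
Lemma integral_mul_ge0_measurable_wrt G X Y : sub_sigma_field G ->
  P.-integrable setT (EFin \o X) -> measurable_wrt G Y -> (forall w, 0 <= Y w) ->
  (forall A, G A -> \int[P]_(w in A) (X w)%:E = 0)%E ->
  P.-integrable setT (fun w => (X w * Y w)%:E) ->
  (\int[P]_w (X w * Y w)%:E = 0)%E.
Proof.
move=> [sG GT] iX mY Y0 X0 iXY.
have mYG : measurable_fun setT (EFin \o Y : g_sigma_algebraType G -> \bar R).
  by apply/measurable_EFinP/measurable_wrtP.
pose g := nnsfun_approx measurableT mYG.
have cg w : EFin \o g^~ w @ \oo --> (Y w)%:E.
  by apply: cvg_nnsfun_approx => // x _; rewrite lee_fin.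
have gY n w : ((g n w)%:E <= (Y w)%:E)%E.
  have ndg : nondecreasing_seq (EFin \o g^~ w).
    by move=> a b ab; rewrite lee_fin; exact/lefP/nd_nnsfun_approx.
  have <- := cvg_unique (@ereal_hausdorff R) (ereal_nondecreasing_cvgn ndg) (cg w).
  by apply: ereal_sup_ubound; exists n.
have mg n : measurable_fun (setT : set T) (g n).
  apply: (@measurable_wrt_measurable _ _ _ G) => //.
  by apply/measurable_wrtP.
have mX : measurable_fun setT X by apply/measurable_EFinP/(measurable_int P).
have int0 n : (\int[P]_w (X w * g n w)%:E = 0)%E.
  have Gg x : G (g n @^-1` [set x]).
    apply: (smallest_sub sG (@subset_refl _ G)).
    exact: (@measurable_funPTI _ _ _ _ (g n) _ (measurable_set1 x)).
  have iXg x : P.-integrable setT (fun w => (X w * \1_(g n @^-1` [set x]) w)%:E).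
    have /integrable_restrict : P.-integrable (setT `&` g n @^-1` [set x]) (EFin \o X).
      by rewrite setTI; apply: integrableS iX => //; exact: GT.
    move=> /(_ (GT _ (Gg x)) measurableT).
    by apply: eq_integrable => // w _; rewrite epatch_indic.
  have Xg0 x : (\int[P]_w (X w * \1_(g n @^-1` [set x]) w)%:E = 0)%E.
    rewrite -(X0 _ (Gg x)) [RHS]integral_mkcond epatch_indic.
    by apply: eq_integral => w _; rewrite EFinM.
  under eq_integral.
    move=> w _; rewrite (fimfunEord (g n)) mulr_sumr -sumEFin.
    under eq_bigr do rewrite mulrCA EFinM.
    over.
  rewrite integral_sum//=; last by move=> i; exact: integrableZl.
  rewrite big1// => i _; rewrite integralZl//.
  by rewrite Xg0 mule0.
have [] := @dominated_convergence _ T R P setT measurableT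
  (fun n w => (X w * g n w)%:E) (fun w => (X w * Y w)%:E)
  (fun w => `|(X w * Y w)%:E|%E).
- by move=> n; apply/measurable_EFinP; exact: measurable_funM.
- exact: (measurable_int P).
- apply: aeW => w _; under eq_fun do rewrite EFinM.
  by rewrite EFinM; apply: cvgeZl => //; exact: cg.
- exact: integrable_abse.
- apply: aeW => w n _; rewrite !abse_EFin lee_fin !normrM.
  rewrite ler_wpM2l// ger0_norm ?fun_ge0// ger0_norm//.
  by have := gY n w; rewrite lee_fin.
- move=> _ _ /cvg_lim <-//.
  rewrite [X in limn X](_ : _ = cst 0%E) ?lim_cst//.
  by apply/funext => n; exact: int0.
Qed.

(** The positive and negative parts of [Y] are at most [|Y|], so their products with [X] stay
    integrable and the nonnegative case applies to each. *)
Lemma integral_mul_measurable_wrt G X Y : sub_sigma_field G ->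
  P.-integrable setT (EFin \o X) -> measurable_wrt G Y ->
  (forall A, G A -> \int[P]_(w in A) (X w)%:E = 0)%E ->
  P.-integrable setT (fun w => (X w * Y w)%:E) ->
  (\int[P]_w (X w * Y w)%:E = 0)%E.
Proof.
move=> GG iX mY X0 iXY; have [sG GT] := GG.
have mX : measurable_fun setT X by apply/measurable_EFinP/(measurable_int P).
have mYT := measurable_wrt_measurable GT mY.
have mYp : measurable_wrt G (Y^\+).
  by apply/measurable_wrtP => //; apply: measurable_funrpos; apply/measurable_wrtP.
have mYn : measurable_wrt G (Y^\-).
  by apply/measurable_wrtP => //; apply: measurable_funrneg; apply/measurable_wrtP.
have iXYp : P.-integrable setT (fun w => (X w * Y^\+ w)%:E).
  apply: le_integrable iXY => //.
    by apply/measurable_EFinP/measurable_funM => //; exact: measurable_funrpos.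
  move=> w _; rewrite !abse_EFin lee_fin !normrM ler_wpM2l//.
  rewrite -[leRHS]/((Num.norm \o Y) w) -funrposDneg.
  by rewrite ger0_norm ?funrpos_ge0// lerDl ?funrneg_ge0.
have iXYn : P.-integrable setT (fun w => (X w * Y^\- w)%:E).
  apply: le_integrable iXY => //.
    by apply/measurable_EFinP/measurable_funM => //; exact: measurable_funrneg.
  move=> w _; rewrite !abse_EFin lee_fin !normrM ler_wpM2l//.
  rewrite -[leRHS]/((Num.norm \o Y) w) -funrposDneg.
  by rewrite ger0_norm ?funrneg_ge0// lerDr ?funrpos_ge0.
under eq_integral.
  move=> w _; rewrite -[X in (_ * X w)%R]funrposBneg mulrBr EFinB. over.
rewrite integralB// !(@integral_mul_ge0_measurable_wrt G) ?sube0//.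
Qed.

(** Pull-out property: testing on [A] in [G] only replaces [Y] by [Y * \1_A], which is again
    measurable with respect to [G]. *)
Lemma is_cond_expectation_mul G X Y : sub_sigma_field G -> measurable_wrt G Y ->
  is_cond_expectation P G X (cst 0) ->
  P.-integrable setT (fun w => (X w * Y w)%:E) ->
  is_cond_expectation P G (fun w => X w * Y w) (cst 0).
Proof.
move=> GG mY [iX i0 m0 X0] iXY; have [sG GT] := GG; split => // A GA.
rewrite integral0 integral_mkcond epatch_indic.
under eq_integral do rewrite -EFinM -mulrA.
rewrite (@integral_mul_measurable_wrt G)//.
- by apply: measurable_wrtM => //; exact: measurable_wrt_indic.
- by move=> B GB; rewrite -X0// integral0.
- have /integrable_restrict : P.-integrable (setT `&` A)
      (EFin \o (fun w => X w * Y w)).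
    by rewrite setTI; apply: integrableS iXY => //; exact: GT.
  move=> /(_ (GT _ GA) measurableT).
  by apply: eq_integrable => // w _; rewrite epatch_indic/= mulrA EFinM.
Qed.
End zero_conditional_expectation.

(** * Independence *)

Section independence.
Context (R : realType) (disp : measure_display) (T : measurableType disp)
  (P : probability T R).

Lemma independent_classes_le (I : finType) (S S' : I -> set (set T)) :
  (forall m, S' m `<=` S m) -> independent_classes P S -> independent_classes P S'.
Proof. by move=> SS iS J A SA; apply: iS => m /SA /SS. Qed.

Lemma independent_classes_lift d (S : 'I_d.+1 -> set (set T)) :
  independent_classes P S -> independent_classes P (fun m => S (lift ord0 m)).
Proof.
move=> iS J A SA.
pose A' m := if unlift ord0 m is Some j then A j else setT.
have := iS (lift ord0 @: J)%SET A'.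
rewrite big_imset/=; last by move=> ? ? _ _ /lift_inj.
under eq_bigr do rewrite /A' liftK.
move=> <-.
- congr (P _); apply/seteqP; split => w Aw m /=.
    by move=> /imsetP[j jJ ->]; rewrite /A' liftK; exact: Aw.
  by move=> jJ; have := Aw (lift ord0 m); rewrite /A' liftK; apply; apply/imsetP; exists m.
- by move=> _ /imsetP[j jJ ->]; rewrite /A' liftK; exact: SA.
Qed.

(** For fixed [A], the finite measures sending [B] to [P (B]&[A)] and to [P A * P B] agree on a
    generating pi-system, hence on the field it generates. *)
Lemma independent_classes_head d (S : 'I_d.+1 -> set (set T)) :
  independent_classes P S -> (forall m, sub_sigma_field (S m)) ->
  forall A B, S ord0 A -> <<s \bigcup_m S (lift ord0 m) >> B ->
    P (A `&` B) = (P A * P B)%E.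
Proof.
move=> iS sS A B SA sB.
have mS m C : S m C -> measurable C by have [_] := sS m; apply.
have ST m : S m setT.
  have [[S0 SC _] _] := sS m; rewrite -(setD0 setT); exact: SC.
have SI m C D : S m C -> S m D -> S m (C `&` D).
  have [sm _] := sS m; rewrite -(sigma_algebra_id sm) => SC SD.
  exact: (@measurableI _ (g_sigma_algebraType (S m))).
have mA := mS _ _ SA.
(* One event is taken from each class. Since [setT] is allowed, [G] contains every single event of a
   class; it is closed under intersection because each class is. *)
pose G : set (set T) := [set \bigcap_m (C m) | C in
  [set C : 'I_d -> set T | forall m, S (lift ord0 m) (C m)]].
have mG : G `<=` measurable.
  by move=> _ [C SC <-]; apply: fin_bigcap_measurable => // m _; exact: mS (SC m).
have GB : <<s G >> B.
  move: B sB; apply: smallest_sub; first exact: smallest_sigma_algebra.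
  move=> C [m _ SC]; apply: sub_sigma_algebra.
  exists (fun j => if j == m then C else setT).
    by move=> j /=; case: eqVneq => [->|_].
  apply/seteqP; split => [w /(_ m I)|w Cw j _]; first by rewrite eqxx.
  by case: ifP.
pose m1 : {measure set T -> \bar R} := mrestr P mA.
pose c : {nonneg R} := NngNum (fine_ge0 (measure_ge0 P A)).
pose m2 : {measure set T -> \bar R} := mscale c P.
have PAE : (fine (P A))%:E = P A by rewrite fineK// fin_num_measure.
suff h : m1 B = m2 B by rewrite setIC -[in RHS]PAE; exact: h.
have GI : setI_closed G.
  move=> _ _ [C SC <-] [D SD <-]; exists (fun m => C m `&` D m).
    by move=> m; exact: SI.
  by rewrite bigcapI.
apply: (@g_sigma_algebra_measure_unique _ _ _ G mG (fun=> setT) _ _ m1 m2 GI _ _ B GB).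
- move=> _; exists (fun=> setT); first by move=> m /=; exact: ST.
  by apply/seteqP; split => // w _ m _.
- by apply/seteqP; split => // w _; exists 0%N.
- move=> _ [C SC <-].
  rewrite -[m1 _]/(P (\bigcap_m C m `&` A)).
  rewrite -[m2 _]/((fine (P A))%:E * P (\bigcap_m C m))%E PAE.
  (* [E] puts [A] at index 0. Independence of the full family and of its tail then gives the product
     formula. *)
  pose E (m : 'I_d.+1) := if unlift ord0 m is Some j then C j else A.
  have SE m : S m (E m).
    by rewrite /E; case: unliftP => [j ->|->//]; exact: SC.
  have := iS [set: 'I_d.+1]%SET E (fun m _ => SE m).
  have iS' : independent_classes P (fun m => S (lift ord0 m)).
    exact: independent_classes_lift.
  have := iS' [set: 'I_d]%SET C (fun m _ => SC m).
  have prodT k (f : 'I_k -> \bar R) :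
      (\prod_(m in [set: 'I_k]%SET) f m = \prod_(m < k) f m)%E.
    by apply: eq_bigl => m; rewrite inE.
  rewrite !prodT big_ord_recl {2}/E unlift_none.
  under [in X in (_ * X)%E]eq_bigr do rewrite /E liftK.
  move=> <-.
  rewrite (_ : \bigcap_(m in _) C m = \bigcap_m C m); last first.
    by apply/seteqP; split => w Cw m _; apply: Cw; rewrite //= inE.
  move=> <-; congr (P _); apply/seteqP; split => [w [Cw Aw] m _|w Ew].
    by rewrite /E; case: unliftP => [j _|_//]; exact: Cw.
  split=> [m _|]; last first.
    by have := Ew ord0; rewrite /E unlift_none; apply; rewrite /= inE.
  by have := Ew (lift ord0 m); rewrite /E liftK; apply; rewrite /= inE.
- move=> _; rewrite -[m1 _]/(P (setT `&` A)) setTI.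
  by apply: le_lt_trans (probability_le1 _ mA) _; exact: ltry.
Qed.

(** The joint law is the product of the marginal laws, as the two agree on rectangles; Tonelli
    factors the integral. *)
Lemma integral_mul_indep (X Y : T -> R) :
  measurable_fun setT X -> measurable_fun setT Y ->
  (forall A B, measurable A -> measurable B ->
    P (X @^-1` A `&` Y @^-1` B) = (P (X @^-1` A) * P (Y @^-1` B))%E) ->
  (forall w, 0 <= X w) -> (forall w, 0 <= Y w) ->
  (\int[P]_w (X w * Y w)%:E = (\int[P]_w (X w)%:E) * (\int[P]_w (Y w)%:E))%E.
Proof.
move=> mX mY iXY X0 Y0.
pose Xm : {mfun T >-> R} := HB.pack X (isMeasurableFun.Build _ _ _ _ X mX).
pose Ym : {mfun T >-> R} := HB.pack Y (isMeasurableFun.Build _ _ _ _ Y mY).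
have mXY : measurable_fun setT (fun w => (X w, Y w)) by exact/measurable_fun_pair.
pose XYm : {mfun T >-> (R * R)%type} :=
  HB.pack (fun w => (X w, Y w)) (isMeasurableFun.Build _ _ _ _ _ mXY).
(* Absolute values make [f] nonnegative on the whole plane and change nothing on the range of
   [(X, Y)]. *)
pose f (z : R * R) : \bar R := (`|z.1| * `|z.2|)%:E.
have mf : measurable_fun setT f.
  apply/measurable_EFinP/measurable_funM; apply: measurableT_comp => //.
have f0 z : (0 <= f z)%E by rewrite lee_fin mulr_ge0.
have := @ge0_integral_distribution _ _ _ _ _ P XYm f mf f0.
under [in RHS]eq_integral do rewrite /f/= !ger0_norm//.
move=> <-.
rewrite (@eq_measure_integral _ _ _ _ (distribution P Xm \x distribution P Ym)%E); last first.
  move=> A mA _; apply/esym; apply: product_measure_unique => //.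
rewrite fubini_tonelli1//.
have mabs : measurable_fun [set: R] (fun x : R => `|x|%:E).
  by apply/measurable_EFinP; exact: normr_measurable.
have absE (Z : {mfun T >-> R}) : (forall w, 0 <= Z w) ->
    (\int[P]_w (Z w)%:E = \int[distribution P Z]_x `|x|%:E)%E.
  move=> Z0; rewrite ge0_integral_distribution//.
  by apply: eq_integral => w _ /=; rewrite ger0_norm.
rewrite (absE Xm)// (absE Ym)// -ge0_integralZr//; last first.
  exact: integral_ge0.
apply: eq_integral => x _; rewrite /fubini_F /f/=.
under eq_integral do rewrite EFinM.
by rewrite ge0_integralZl.
Qed.
End independence.

(** * Norms of random variables *)

Section Lnorm_probability.
Context (R : realType) (disp : measure_display) (T : measurableType disp)
  (P : probability T R).
Implicit Types (X Y : T -> R) (p c : R).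
Local Open Scope ereal_scope.
Import HBNNSimple.

Lemma Lnorm_EFin p X :
  'N[P]_(p%:E)[EFin \o X] = (\int[P]_w (`|X w| `^ p)%R%:E) `^ p^-1.
Proof. by rewrite unlock. Qed.

Lemma measurable_abs_powR p X : measurable_fun setT X ->
  measurable_fun setT (fun w => (`|X w| `^ p)%R).
Proof.
move=> mX; apply: (measurableT_comp (measurable_powR p)).
exact: measurableT_comp.
Qed.

Lemma Lnorm_indep p X Y : measurable_fun setT X -> measurable_fun setT Y ->
  (forall A B, measurable A -> measurable B ->
    P (X @^-1` A `&` Y @^-1` B) = P (X @^-1` A) * P (Y @^-1` B)) ->
  'N[P]_(p%:E)[EFin \o (fun w => (X w * Y w)%R)] =
  'N[P]_(p%:E)[EFin \o X] * 'N[P]_(p%:E)[EFin \o Y].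
Proof.
move=> mX mY iXY; rewrite !Lnorm_EFin -poweRM; last 2 first.
- by apply: integral_ge0 => w _; rewrite lee_fin powR_ge0.
- by apply: integral_ge0 => w _; rewrite lee_fin powR_ge0.
rewrite -integral_mul_indep; [|exact: measurable_abs_powR..| | |]; last 2 first.
- by move=> w; exact: powR_ge0.
- by move=> w; exact: powR_ge0.
- by under eq_integral do rewrite normrM powRM//.
move=> A B mA mB; pose f := fun x : R => (`|x| `^ p)%R.
have mf : measurable_fun [set: R] f.
  by apply: (measurableT_comp (measurable_powR p)); exact: normr_measurable.
apply: (iXY (f @^-1` A) (f @^-1` B)).
- by rewrite -[_ @^-1` _]setTI; exact: mf.
- by rewrite -[_ @^-1` _]setTI; exact: mf.
Qed.

Lemma Lnorm_scale p c X : (p != 0)%R -> measurable_fun setT X ->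
  'N[P]_(p%:E)[EFin \o (fun w => (c * X w)%R)] = `|c|%:E * 'N[P]_(p%:E)[EFin \o X].
Proof.
move=> p0 mX; rewrite !Lnorm_EFin.
under eq_integral do rewrite normrM powRM// EFinM.
rewrite ge0_integralZl//; last exact/measurable_EFinP/measurable_abs_powR.
rewrite poweRM ?lee_fin ?powR_ge0//; last first.
  by apply: integral_ge0 => w _; rewrite lee_fin powR_ge0.
by rewrite -poweR_EFin -poweRrM divff// poweRe1// lee_fin.
Qed.

Lemma Lnorm_cst p c : (p != 0)%R -> 'N[P]_(p%:E)[EFin \o (cst c : T -> R)] = `|c|%:E.
Proof.
move=> p0; have := @Lnorm_scale p c (cst 1%R) p0 (measurable_cst _).
under [in X in X = _ -> _]eq_fun do rewrite /= mulr1.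
move=> ->; rewrite (_ : EFin \o _ = cst 1)// Lnorm_cst1.
by rewrite [X in X `^ _](probability_setT P) poweR1r mule1.
Qed.

(** The total mass is finite, so L^p embeds in L^1. *)
Lemma Lnorm_lty_integrable p X : (1 <= p)%R -> measurable_fun setT X ->
  'N[P]_(p%:E)[EFin \o X] < +oo -> P.-integrable setT (EFin \o X).
Proof.
move=> p1 mX Xoo; apply/Lfun1_integrable.
apply: (@Lfun_subset _ _ _ P 1 p%:E) => //.
  by rewrite [X in X \is a _](probability_setT P).
by rewrite inE; apply/andP; split; rewrite inE.
Qed.

(* [f] need not be measurable: it will be built from a pointwise [limn], which
   is a junk value off the set of convergence. *)
Lemma le_integral_ae_ge0 (f g : T -> \bar R) : (forall w, 0 <= f w) ->
  (forall w, 0 <= g w) -> measurable_fun setT g -> {ae P, forall w, f w <= g w} ->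
  \int[P]_w f w <= \int[P]_w g w.
Proof.
move=> f0 g0 mg fg; rewrite [leLHS]ge0_integralTE//.
apply: ge_ereal_sup => _ [h /= hf <-].
rewrite -integralT_nnsfun; apply: ae_ge0_le_integral => //.
- by move=> w _; rewrite lee_fin.
- exact/measurable_EFinP.
- by apply: filterS fg => w fgw _; exact: le_trans fgw.
Qed.

Lemma Lnorm_limn_le p c (V : nat -> T -> R) : (0 < p)%R -> (0 <= c)%R ->
  (forall n, measurable_fun setT (V n)) ->
  {ae P, forall w, cvgn (fun n => V n w)} ->
  (forall n, 'N[P]_(p%:E)[EFin \o V n] <= c%:E) ->
  'N[P]_(p%:E)[EFin \o (fun w => limn (fun n => V n w))] <= c%:E.
Proof.
move=> p0 c0 mV cV Vc.
have ppos : (p^-1 >= 0)%R by rewrite invr_ge0 ltW.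
suff h : \int[P]_w (`|limn (fun n => V n w)| `^ p)%:E <= (c `^ p)%:E.
  rewrite Lnorm_EFin.
  have -> : c%:E = (c `^ p)%:E `^ p^-1.
    by rewrite poweR_EFin -powRrM divff ?gt_eqF// powRr1.
  apply: gt0_ler_poweR => //; rewrite in_itv/= leey andbT.
  - by apply: integral_ge0 => w _; rewrite lee_fin powR_ge0.
  - by rewrite lee_fin powR_ge0.
pose u n w := (`|V n w| `^ p)%:E.
have mu n : measurable_fun setT (u n).
  by apply/measurable_EFinP; exact: measurable_abs_powR.
have u0 n w : 0 <= u n w by rewrite lee_fin powR_ge0.
have einfE (v : (\bar R)^nat) : limn_einf v = ereal_sup (range (einfs v)).
  by rewrite limn_einf_lim; apply/cvg_lim => //; exact: cvg_einfs_sup.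
have le_einf (v : (\bar R)^nat) a n : (forall k, (n <= k)%N -> a <= v k) ->
    a <= limn_einf v.
  move=> av; rewrite einfE.
  apply: le_trans (ereal_sup_ubound _); last by exists n.
  by apply: le_ereal_inf_tmp => _ [k /= nk <-]; exact: av.
have einf_le (v : (\bar R)^nat) a : (forall k, v k <= a) -> limn_einf v <= a.
  move=> va; rewrite einfE.
  apply: ge_ereal_sup => _ [k _ <-]; apply: le_trans (va k).
  by apply: ereal_inf_lbound; exists k => /=.
apply: (@le_trans _ _ (\int[P]_w limn_einf (u ^~ w))).
  apply: le_integral_ae_ge0.
  - by move=> w; rewrite lee_fin powR_ge0.
  - by move=> w; apply: (le_einf _ _ 0%N).
  - apply: measurableT_comp; first exact: oppe_measurable.
    apply: (@measurable_fun_limn_esup _ _ _ _ (fun n w => - u n w)) => n.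
    exact: measurableT_comp.
  (* A lower limit [e] below the p-th power of [|l|] would be finite. The midpoint [z] of the two is
     contradictory: [|V n|] eventually exceeds its p-th root. *)
  - apply: filterS cV => w cw; set l := limn _; rewrite leNgt; apply/negP => lt_l.
    have : limn_einf (u ^~ w) \is a fin_num.
      rewrite ge0_fin_numE; last by apply: (le_einf _ _ 0%N).
      by apply: lt_trans lt_l _; exact: ltry.
    move=> /fineK; set e := fine _ => eE; move: lt_l; rewrite -eE lte_fin => e_lt.
    have e0 : (0 <= e)%R by rewrite -lee_fin eE; apply: (le_einf _ _ 0%N).
    pose z := ((e + `|l| `^ p) / 2)%R.
    have [ez zl] := midf_lt e_lt.
    have z0 : (0 <= z)%R by apply: le_trans (ltW ez).
    have zpE : ((z `^ p^-1) `^ p = z)%R by rewrite -powRrM mulVf ?gt_eqF// powRr1.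
    have zpl : (z `^ p^-1 < `|l|)%R.
      rewrite ltNge; apply/negP => /(ge0_ler_powR (ltW p0)).
      by rewrite zpE !nnegrE powR_ge0 normr_ge0 leNgt zl => /(_ isT isT).
    have [n _ nV] := cvgr_norm_gt _ cw _ zpl.
    (* Monotonicity of [powR] gives the lower semicontinuity that Fatou needs. *)
    suff : z%:E <= limn_einf (u ^~ w) by rewrite -eE lee_fin leNgt ez.
    apply: (le_einf _ _ n) => k nk; rewrite lee_fin -zpE.
    apply: ge0_ler_powR; rewrite ?nnegrE ?powR_ge0 ?normr_ge0 ?(ltW p0)//.
    exact/ltW/nV.
apply: le_trans; first by apply: fatou => // n w _; exact: u0.
apply: einf_le => k.
have := Vc k; rewrite Lnorm_EFin => /(gt0_ler_poweR (ltW p0)).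
rewrite -poweRrM mulVf ?gt_eqF// poweRe1; last by apply: integral_ge0.
by rewrite !in_itv/= poweR_ge0 lee_fin c0 !leey => /(_ isT isT).
Qed.
End Lnorm_probability.

(** * Multi-indices and polynomials *)

Section multi_indices.
Implicit Types (d n N : nat).

(** Strict increase is absorbed into the lower bound [i.+1] of the tail, which makes recursion on
    the smallest index possible. *)
Lemma multi_indices_cons d n N i (J : d.-tuple nat) :
  multi_indices d.+1 n (Some N) (cons_tuple i J) <->
  (n <= i <= N)%N /\ multi_indices d i.+1 (Some N) J.
Proof.
rewrite /multi_indices/= (path_sortedE ltn_trans); split.
  move=> [/andP[iJ sJ] IN]; split; first by have := IN ord0; rewrite tnth0.
  split => // m; have := IN (lift ord0 m); rewrite tnthS => /andP[_ JN].
  by apply/andP; split => //; move/all_tnthP : iJ; apply.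
move=> [/andP[ni iN] [sJ JN]]; split.
  by rewrite sJ andbT; apply/all_tnthP => m; have /andP[] := JN m.
move=> m; case: (unliftP ord0 m) => [j|] ->; rewrite ?tnth0 ?tnthS.
  have /andP[iJ JlN] := JN j; rewrite /index_range/= JlN andbT.
  by rewrite (leq_trans ni)// ltnW.
by rewrite /index_range/= ni iN.
Qed.

Lemma multi_indices0 n (N : option nat) : multi_indices 0 n N = [set [tuple]].
Proof.
by apply/seteqP; split => [I _|I ->]; [rewrite [I]tuple0|split => // -[]].
Qed.

Lemma finite_multi_indices d n N : finite_set (multi_indices d n (Some N)).
Proof.
elim: d n => [|d IH] n; first by rewrite multi_indices0; exact: finite_set1.
apply: (@sub_finite_set _ _
  (\bigcup_(i in `I_N.+1) ((fun J => cons_tuple i J) @` multi_indices d i.+1 (Some N)))).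
  move=> I; rewrite (tuple_eta I) => /multi_indices_cons[/andP[_ iN] JN].
  by exists (thead I) => //; exists (behead_tuple I).
apply: bigcup_finite; first exact: finite_II.
by move=> i _; exact: finite_image.
Qed.

Lemma multi_indices_gt d n N : (N < n)%N -> multi_indices d.+1 n (Some N) = set0.
Proof.
move=> Nn; apply/seteqP; split => // I [_ /(_ ord0)/andP[nI IN]].
by have := leq_trans nI IN; rewrite leqNgt Nn.
Qed.

(** Induction on the length of the range: the tuples starting with [n] are split off, and the others
    have lower bound [n.+1]. *)
Lemma fsbig_multi_indices_recl (R : Type) (idx : R) (op : Monoid.com_law idx)
    d n N (f : d.+1.-tuple nat -> R) :
  \big[op/idx]_(I \in multi_indices d.+1 n (Some N)) f I =
  \big[op/idx]_(n <= i < N.+1)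
    \big[op/idx]_(J \in multi_indices d i.+1 (Some N)) f (cons_tuple i J).
Proof.
move eqk : (N.+1 - n)%N => k; elim: k n eqk => [|k IH] n nk.
  have Nn : (N < n)%N by rewrite -subn_eq0 nk.
  by rewrite multi_indices_gt// fsbig_set0 big_geq.
have nN : (n < N.+1)%N by rewrite -subn_gt0 nk.
rewrite big_ltn// -IH; last by rewrite subnS nk.
rewrite -(@fsbig_image _ _ _ _ _ (multi_indices d n.+1 (Some N)) (fun J => cons_tuple n J) f); last first.
  by move=> J J' _ _ /(congr1 val)/= [] /val_inj.
rewrite -fsbigU0.
- apply: eq_fsbigl; apply/seteqP; split => I.
    rewrite (tuple_eta I) => /multi_indices_cons[/andP[nI IN] JN].
    have [In|In|In] := ltngtP n (thead I).
    + by right; apply/multi_indices_cons; rewrite In IN.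
    + by move: nI; rewrite leqNgt In.
    + by left; exists (behead_tuple I) => //=; rewrite In.
  case=> [[J JN <-]|].
    by apply/multi_indices_cons; rewrite leqnn -ltnS nN.
  rewrite (tuple_eta I) => /multi_indices_cons[/andP[nI IN] JN].
  by apply/multi_indices_cons; rewrite (ltnW nI) IN.
- exact/finite_image/finite_multi_indices.
- exact: finite_multi_indices.
- move=> I [[J JN <-] /multi_indices_cons[]]; by rewrite ltnn.
Qed.

End multi_indices.

(** * Recursion of the polynomial on its smallest index *)

Section rpoly_fin.
Context (R : realType) (disp : measure_display) (T : measurableType disp).

Lemma rpoly_fin0 n N (xi : nat -> 'I_0 -> T -> R) b w :
  rpoly_fin n N xi b w = b [tuple].
Proof. by rewrite /rpoly_fin multi_indices0 fsbig_set1 big_ord0 mulr1. Qed.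

Lemma rpoly_finS d n N (xi : nat -> 'I_d.+1 -> T -> R) b w :
  rpoly_fin n N xi b w = \sum_(n <= i < N.+1) xi i ord0 w *
    rpoly_fin i.+1 N (fun j m => xi j (lift ord0 m)) (fun J => b (cons_tuple i J)) w.
Proof.
rewrite /rpoly_fin fsbig_multi_indices_recl; apply: eq_bigr => i _.
rewrite mulr_fsumr; apply: eq_fsbigr => J _.
rewrite big_ord_recl tnth0 mulrCA; congr (_ * (_ * _)).
by apply: eq_bigr => m _; rewrite tnthS.
Qed.

(** [G] is left free: it will be the field of the remaining vectors, a field containing [F i.+1], or
    the class of all measurable sets. *)
Lemma measurable_wrt_rpoly_fin (G : set (set T)) d n N
    (xi : nat -> 'I_d -> T -> R) b : sigma_algebra setT G ->
  (forall i m, (n <= i <= N)%N -> measurable_wrt G (xi i m)) ->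
  measurable_wrt G (rpoly_fin n N xi b).
Proof.
move=> sG; elim: d n xi b => [|d IH] n xi b mxi.
  rewrite (_ : rpoly_fin _ _ _ _ = cst (b [tuple])).
    exact: measurable_wrt_cst.
  by apply/funext => w; rewrite rpoly_fin0.
rewrite (_ : rpoly_fin _ _ _ _ = fun w => \sum_(i <- index_iota n N.+1 | (n <= i <= N)%N)
    xi i ord0 w * rpoly_fin i.+1 N (fun j m => xi j (lift ord0 m))
                   (fun J => b (cons_tuple i J)) w); last first.
  apply/funext => w; rewrite rpoly_finS big_nat; apply: eq_bigl => i.
  by rewrite ltnS.
apply: measurable_wrt_sum => // i /andP[ni iN].
apply: measurable_wrtM => //; first by apply: mxi; rewrite ni iN.
apply: IH => j m /andP[ij jN]; apply: mxi.
by rewrite jN (leq_trans ni)// ltnW.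
Qed.

End rpoly_fin.

(** * The inequality for finite N *)

Section nnsup.
Context (R : realType).
Local Open Scope ereal_scope.

Lemma nnsup_le (A : set (\bar R)) c : 0 <= c -> (forall x, A x -> x <= c) ->
  nnsup A <= c.
Proof. by move=> c0 Ac; apply: ge_ereal_sup => x [->//|/Ac]. Qed.

Lemma le_nnsup (A : set (\bar R)) x : A x -> x <= nnsup A.
Proof. by move=> Ax; apply: ereal_sup_ubound; right. Qed.

Lemma nnsup_ge0 (A : set (\bar R)) : 0 <= nnsup A.
Proof. by apply: ereal_sup_ubound; left. Qed.

End nnsup.

(** * Restricting index ranges and fields *)

Section reverse_martingale_differences.
Context (R : realType) (disp : measure_display) (T : measurableType disp)
  (P : probability T R).

(** Lets conditional means be checked at [F i.+1] alone, as the later fields of a reverse filtration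
    are smaller. *)
Lemma is_cond_expectation_sub (G H : set (set T)) (X : T -> R) :
  sub_sigma_field H -> H `<=` G ->
  is_cond_expectation P G X (cst 0) -> is_cond_expectation P H X (cst 0).
Proof.
move=> [sH _] HG [iX i0 _ X0]; split => // [|A /HG]; last exact: X0.
exact: measurable_wrt_cst.
Qed.

(** Conditioning on this field expresses plain zero mean; it serves the last index of a finite
    range. *)
Lemma trivial_sub_sigma_field :
  sub_sigma_field [set A : set T | A = set0 \/ A = setT].
Proof.
split; last by move=> A [->|->].
split; first by left.
  by move=> A [->|->]; [right; rewrite setD0|left; rewrite setDv].
move=> A A01; have [[k Ak]|nA] := pselect (exists k, A k = setT).
  by right; apply/seteqP; split => // w _; exists k => //; rewrite Ak.
left; apply/seteqP; split => // w [k _].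
by have [->//|Ak] := A01 k; case: nA; exists k.
Qed.

Lemma index_range_sub n n' (N N' : option nat) : (n <= n')%N ->
  (forall i, (if N' is Some N' then i <= N' else true)%N ->
             (if N is Some N then i <= N else true)%N) ->
  index_range n' N' `<=` index_range n N.
Proof.
by move=> nn' NN' i /andP[n'i iN']; apply/andP; split; [exact: leq_trans n'i|exact: NN'].
Qed.

Lemma reverse_martingale_differences_sub n n' N N' F (x : nat -> T -> R) :
  index_range n' N' `<=` index_range n N ->
  reverse_martingale_differences P n N F x ->
  reverse_martingale_differences P n' N' F x.
Proof.
move=> sD [FS FF mx cx ex]; split.
- by move=> i /sD; exact: FS.
- by move=> i /sD Di /sD; exact: FF.
- by move=> i /sD; exact: mx.
- by move=> i /sD; exact: cx.
- by move=> i k /sD Di /sD; exact: ex.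
Qed.

Lemma vector_sigma_algebra_sub n n' N N' (x : nat -> T -> R) :
  index_range n' N' `<=` index_range n N ->
  vector_sigma_algebra n' N' x `<=` vector_sigma_algebra n N x.
Proof.
by move=> sD; apply: sub_sigma_algebra2 => A [i /sD Di xA]; exists i.
Qed.

Lemma measurable_wrt_vector_sigma_algebra n N (x : nat -> T -> R) i :
  index_range n N i -> measurable_wrt (vector_sigma_algebra n N x) (x i).
Proof.
move=> Di B mB; apply: sub_sigma_algebra; exists i => //.
by exists B => //; rewrite setTI.
Qed.

Lemma vector_sigma_algebra_sub_sigma_field n N (x : nat -> T -> R) :
  (forall i, index_range n N i -> measurable_fun setT (x i)) ->
  sub_sigma_field (vector_sigma_algebra n N x).
Proof.
move=> mx; split; first exact: smallest_sigma_algebra.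
apply: smallest_sub; first exact: sigma_algebra_measurable.
by move=> _ [i Di [B mB <-]]; exact: mx.
Qed.

Lemma reverse_filtration_le n N F (x : nat -> T -> R) i k :
  reverse_martingale_differences P n (Some N) F x ->
  (n <= i)%N -> (i <= k)%N -> (k <= N)%N -> F k `<=` F i.
Proof.
move=> [_ FF _ _ _] ni; elim: k => [|k IH].
  by rewrite leqn0 => /eqP -> _ A.
rewrite leq_eqVlt => /predU1P[-> _ A//|ik kN].
have kD : index_range n (Some N) k by rewrite /index_range/=; lia.
have k1D : index_range n (Some N) k.+1 by rewrite /index_range/=; lia.
apply: subset_trans (FF _ kD k1D) _; apply: IH; lia.
Qed.

Lemma measurable_reverse_martingale_differences n N F (x : nat -> T -> R) i :
  reverse_martingale_differences P n N F x -> index_range n N i ->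
  measurable_fun setT (x i).
Proof.
move=> [FS _ mx _ _] Di; apply: measurable_wrt_measurable (mx i Di).
by have [] := FS i Di.
Qed.

(** A vanishing sum of squares kills every coefficient. This covers the arrays that cannot be
    normalised. *)
Lemma rpoly_fin_eq0 d n N (xi : nat -> 'I_d -> T -> R) b w :
  \sum_(I \in multi_indices d n (Some N)) b I ^+ 2 = 0 -> rpoly_fin n N xi b w = 0.
Proof.
move=> b0; apply: fsbig1 => I NI; suff /eqP : b I ^+ 2 = 0.
  by rewrite sqrf_eq0 => /eqP ->; rewrite mul0r.
move: I NI; apply: (pfsumr_eq0 _ _ b0); first exact: finite_multi_indices.
by move=> I _; exact: sqr_ge0.
Qed.

End reverse_martingale_differences.

(** * The moment bound, by induction on the degree *)

Section polynomial_inequality.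
Context (R : realType) (disp : measure_display) (T : measurableType disp)
  (P : probability T R).
Variables (p K : R).
Hypotheses (p1 : 1 <= p) (K0 : 0 <= K) (KM_K : KM_admissible p K).

(** Replacing [j] by [N - j] makes the decreasing fields increase, so [KM_admissible] applies to the
    [N.+1 - n] terms. *)
Lemma Lnorm_reverse_martingale_differences_le n N F (theta : nat -> T -> R)
    (c : nat -> R) (C : R) :
  reverse_martingale_differences P n (Some N) F theta ->
  0 <= C ->
  (forall i, (n <= i <= N)%N -> ('N[P]_(p%:E)[EFin \o theta i] <= C%:E)%E) ->
  \sum_(n <= i < N.+1) c i ^+ 2 = 1 ->
  ('N[P]_(p%:E)[EFin \o (fun w => \sum_(n <= i < N.+1) c i * theta i w)%R] <=
   (K * C)%:E)%E.
Proof.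
move=> [FS FF mth cth eth] C0 thC c1.
have inD j : (j < N.+1 - n)%N -> index_range n (Some N) (N - j)%N.
  by rewrite /index_range/= => jk; lia.
have rev (f : nat -> R) :
    \sum_(n <= i < N.+1) f i = \sum_(j < N.+1 - n) f (N - j)%N.
  rewrite big_rev_mkord; apply: eq_bigr => j _; by rewrite subSS.
rewrite (_ : (fun w => _) = fun w => \sum_(j < N.+1 - n) c (N - j)%N * theta (N - j)%N w); last first.
  by apply/funext => w; rewrite (rev (fun i => c i * theta i w)).
have := @KM_K _ _ P (N.+1 - n)%N (fun j => F (N - j)%N) (fun j => theta (N - j)%N)
  (fun j => c (N - j)%N).
move=> /(_ _ _)/le_trans; apply.
- split.
  + by move=> i /inD; exact: FS.
  + move=> i ik; have := FF (N - i.+1)%N.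
    rewrite (_ : (N - i.+1).+1 = N - i)%N; last by lia.
    by apply; apply: inD => //; exact: ltnW.
  + by move=> i /inD; exact: mth.
  + by move=> i /inD; exact: cth.
  + move=> i j ji ik; apply: eth; [exact: inD|apply: inD; exact: ltn_trans ik|lia].
- by rewrite -(rev (fun i => c i ^+ 2)).
rewrite EFinM lee_wpmul2l ?lee_fin//.
apply: nnsup_le; first by rewrite lee_fin.
by move=> _ [j /= /inD Dj <-]; exact: thC.
Qed.


(** The array is not normalised: the root of its sum of squares stays in the bound, so that the
    induction hypothesis applies to every section of [b] at a fixed smallest index. *)
Lemma rpoly_fin_Lnorm_le d n N F (xi : nat -> 'I_d -> T -> R) b (nu : 'I_d -> R) :
  (forall m, 0 <= nu m) ->
  (forall m, reverse_martingale_differences P n (Some N) F (xi ^~ m)) ->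
  independent_classes P (fun m => vector_sigma_algebra n (Some N) (xi ^~ m)) ->
  (forall i m, (n <= i <= N)%N -> ('N[P]_(p%:E)[EFin \o xi i m] <= (nu m)%:E)%E) ->
  ('N[P]_(p%:E)[EFin \o rpoly_fin n N xi b] <=
   (\prod_m (K * nu m) *
    Num.sqrt (\sum_(I \in multi_indices d n (Some N)) b I ^+ 2))%:E)%E.
Proof.
have p0 : p != 0 by rewrite gt_eqF// (lt_le_trans ltr01).
elim: d n xi b nu => [|d IH] n xi b nu nu0 rmd ind xinu.
  rewrite (_ : rpoly_fin _ _ _ _ = cst (b [tuple])); last first.
    by apply/funext => w; rewrite rpoly_fin0.
  by rewrite Lnorm_cst// multi_indices0 fsbig_set1 big_ord0 mul1r sqrtr_sqr.
pose xi' j m := xi j (lift ord0 m).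
(* [W i] multiplies [xi i ord0] in the expansion, and [B2 i] is the squared norm of its array. *)
pose W i := rpoly_fin i.+1 N xi' (fun J => b (cons_tuple i J)).
pose B2 i := \sum_(J \in multi_indices d i.+1 (Some N)) b (cons_tuple i J) ^+ 2.
pose C := \prod_(m < d) (K * nu (lift ord0 m)).
have B20 i : 0 <= B2 i by apply: fsumr_ge0 => J _; exact: sqr_ge0.
have C0 : 0 <= C by apply: prodr_ge0 => m _; exact: mulr_ge0.
have sumB2 : \sum_(I \in multi_indices d.+1 n (Some N)) b I ^+ 2 =
    \sum_(n <= i < N.+1) B2 i by rewrite fsbig_multi_indices_recl.
rewrite sumB2; set S := \sum_(n <= i < N.+1) B2 i.
have S0 : 0 <= S by apply: sumr_ge0.
have subD i : (n <= i)%N -> index_range i.+1 (Some N) `<=` index_range n (Some N).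
  by move=> ni; apply: index_range_sub => //; exact: leqW.
have rmd' i m : (n <= i)%N ->
    reverse_martingale_differences P i.+1 (Some N) F (xi' ^~ m).
  by move=> ni; apply: reverse_martingale_differences_sub (rmd _); exact: subD.
have NW i : (n <= i)%N -> ('N[P]_(p%:E)[EFin \o W i] <= (C * Num.sqrt (B2 i))%:E)%E.
  move=> ni; apply: IH => //.
  - by move=> m; exact: rmd'.
  - apply: independent_classes_le (independent_classes_lift ind) => m.
    by apply: vector_sigma_algebra_sub; exact: subD.
  - by move=> j m /andP[ij jN]; apply: xinu; rewrite jN andbT (leq_trans ni)// ltnW.
(* For [B2 i = 0] the junk value [0^-1 = 0] is harmless, since [W i = 0]. *)
pose theta i w := xi i ord0 w * ((Num.sqrt (B2 i))^-1 * W i w).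
have thetaE i w : Num.sqrt (B2 i) * theta i w = xi i ord0 w * W i w.
  rewrite /theta mulrCA; have [B0|B0] := eqVneq (B2 i) 0.
    by have -> : W i w = 0 by [exact: rpoly_fin_eq0]; rewrite !mulr0.
  by rewrite mulVKf// sqrtr_eq0 -ltNge lt0r B0 B20.
pose sig m := vector_sigma_algebra n (Some N) (xi ^~ m).
have sigF m : sub_sigma_field (sig m).
  apply: vector_sigma_algebra_sub_sigma_field => i Di.
  exact: measurable_reverse_martingale_differences (rmd m) Di.
have mxi i m : (n <= i <= N)%N -> measurable_fun setT (xi i m).
  by move=> Di; exact: measurable_reverse_martingale_differences (rmd m) Di.
(* [H] collects all vectors but the first. Each [W i] is measurable for it, hence independent of
   [xi i ord0]. *)
pose H : set (set T) := <<s \bigcup_m sig (lift ord0 m) >>.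
have HF : sub_sigma_field H.
  split; first exact: smallest_sigma_algebra.
  apply: smallest_sub; first exact: sigma_algebra_measurable.
  by move=> A [m _ sA]; have [_] := sigF (lift ord0 m); apply.
have mWH i : (n <= i)%N ->
    measurable_wrt H (W i).
  move=> ni; have [sH _] := HF.
  apply: measurable_wrt_rpoly_fin => // j m Dj.
  apply: (@measurable_wrt_sub _ _ _ (sig (lift ord0 m))).
    by move=> A sA; apply: sub_sigma_algebra; exists m.
  exact: (@measurable_wrt_vector_sigma_algebra _ _ _ n (Some N) (xi ^~ _) j (subD i ni j Dj)).
have mYH i : (n <= i)%N ->
    measurable_wrt H (fun w => (Num.sqrt (B2 i))^-1 * W i w).
  move=> ni; have [sH _] := HF.
  by apply: measurable_wrtM (mWH i ni) => //; exact: measurable_wrt_cst.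
have mWT i : (n <= i)%N -> measurable_fun setT (fun w => (Num.sqrt (B2 i))^-1 * W i w).
  by move=> ni; have [_ HT] := HF; exact: measurable_wrt_measurable HT (mYH i ni).
(* Dividing by the weight makes the bound uniform in [i], to match the supremum in the definition of
   K_M. *)
have Ntheta i : (n <= i <= N)%N ->
    ('N[P]_(p%:E)[EFin \o theta i] <= (nu ord0 * C)%:E)%E.
  move=> Di; have /andP[ni iN] := Di.
  rewrite Lnorm_indep; [|exact: mxi|exact: mWT|]; last first.
    move=> A B mA mB; apply: (independent_classes_head ind sigF).
      exact: (@measurable_wrt_vector_sigma_algebra _ _ _ n (Some N) (xi ^~ ord0) i Di).
    exact: mYH.
  rewrite EFinM lee_pmul ?Lnorm_ge0//; first exact: xinu.
  have mW : measurable_fun setT (W i).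
    by have [_ HT] := HF; exact: measurable_wrt_measurable HT (mWH i ni).
  rewrite Lnorm_scale// ger0_norm ?invr_ge0 ?sqrtr_ge0//.
  have [B0|B0] := eqVneq (B2 i) 0; first by rewrite B0 sqrtr0 invr0 mul0e lee_fin.
  have sB0 : 0 < Num.sqrt (B2 i) by rewrite sqrtr_gt0 lt0r B0 B20.
  apply: le_trans (lee_wpmul2l _ (NW i ni)) _; first by rewrite lee_fin invr_ge0 ltW.
  by rewrite -EFinM mulrCA mulVf ?gt_eqF// mulr1.
have thetaF : reverse_martingale_differences P n (Some N) F theta.
  have itheta i : (n <= i <= N)%N -> P.-integrable setT (EFin \o theta i).
    move=> Di; have /andP[ni iN] := Di; apply: (@Lnorm_lty_integrable _ _ _ _ p) => //.
      by apply: measurable_funM; [exact: mxi|exact: mWT].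
    by rewrite (le_lt_trans (Ntheta i Di)) ?ltry.
  (* [G] will be [F i], [F i.+1] or the trivial field. *)
  have mWG i (G : set (set T)) : (n <= i <= N)%N -> sub_sigma_field G ->
      ((i < N)%N -> F i.+1 `<=` G) ->
      measurable_wrt G (fun w => (Num.sqrt (B2 i))^-1 * W i w).
    move=> /andP[ni iN] [sG _] FG.
    apply: measurable_wrtM => //; first exact: measurable_wrt_cst.
    apply: measurable_wrt_rpoly_fin => // j m /andP[ij jN].
    have [_ _ mF _ _] := rmd (lift ord0 m).
    apply: measurable_wrt_sub (mF j _); last by rewrite /index_range/=; lia.
    apply: (@subset_trans _ (F i.+1)); last by apply: FG; exact: leq_trans jN.
    apply: (reverse_filtration_le (rmd ord0)) => //; lia.
  have [FS FF mF cF eF] := rmd ord0.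
  have cond i G : (n <= i <= N)%N -> sub_sigma_field G ->
      ((i < N)%N -> F i.+1 `<=` G) ->
      is_cond_expectation P G (xi i ord0) (cst 0) ->
      is_cond_expectation P G (theta i) (cst 0).
    by move=> Di GF FG eG; apply: (is_cond_expectation_mul GF (mWG i G Di GF FG) eG (itheta i Di)).
  split => //.
  - move=> i Di; have [sFi _] := FS i Di.
    apply: measurable_wrtM => //; first exact: mF.
    apply: mWG => //; first exact: FS.
    by move=> iN; apply: FF => //; move: Di; rewrite /index_range/=; lia.
  (* The mean is zero because the conditional expectation over some field is: it is tested on the
     event [setT]. *)
  - move=> i Di; split; first exact: itheta.
    have [G [GF FG eG]] : exists G, [/\ sub_sigma_field G, (i < N)%N -> F i.+1 `<=` G &
        is_cond_expectation P G (xi i ord0) (cst 0)].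
      have [iN|Ni] := ltnP i N.
        have D1 : index_range n (Some N) i.+1.
          by move: Di; rewrite /index_range/=; lia.
        by exists (F i.+1); split; [exact: FS|move=> _ A|exact: eF].
      (* [F i.+1] is unconstrained for [i = N], but then [W i] is constant. *)
      exists [set A : set T | A = set0 \/ A = setT].
      split; [exact: trivial_sub_sigma_field|by move=> iN; lia|].
      have [ix Ex] := cF i Di; split => //.
      + exact: integrable0.
      + by apply: measurable_wrt_cst; have [] := trivial_sub_sigma_field T.
      + move=> A [->|->]; first by rewrite !integral_set0.
        by move: Ex; rewrite integral0 unlock => ->.
    have [_ _ _ Etheta] := cond i G Di GF FG eG.
    rewrite unlock -Etheta ?integral0//.
    by have [[G0 GC _] _] := GF; rewrite -(setD0 setT); exact: GC.
  (* It suffices to condition on [F i.+1], which contains [F k] and for which [W i] is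
     measurable. *)
  - move=> i k Di Dk ik.
    have D1 : index_range n (Some N) i.+1.
      by move: Di Dk; rewrite /index_range/=; lia.
    apply: (@is_cond_expectation_sub _ _ _ _ (F i.+1)) => //; first exact: FS.
      apply: (reverse_filtration_le (rmd ord0)) => //;
        by move: Di Dk; rewrite /index_range/=; lia.
    by apply: cond; [exact: Di|exact: FS|move=> _ A|exact: eF].
have [S_eq0|S_neq0] := eqVneq S 0.
  rewrite (_ : rpoly_fin _ _ _ _ = cst 0).
    by rewrite Lnorm_cst// S_eq0 sqrtr0 mulr0 normr0.
  by apply/funext => w; apply: rpoly_fin_eq0; rewrite sumB2.
have S_gt0 : 0 < S by rewrite lt0r S_neq0.
have sqS_gt0 : 0 < Num.sqrt S by rewrite sqrtr_gt0.
(* The squares of these weights sum to 1, since [S] is the sum of the [B2 i]; the factor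
   [Num.sqrt S] is restored outside. *)
pose c i := Num.sqrt (B2 i) / Num.sqrt S.
rewrite (_ : rpoly_fin _ _ _ _ = fun w => Num.sqrt S *
    \sum_(n <= i < N.+1) c i * theta i w); last first.
  apply/funext => w; rewrite rpoly_finS mulr_sumr; apply: eq_bigr => i _.
  by rewrite -[LHS]thetaE mulrA; congr (_ * _); rewrite /c mulrC divfK// gt_eqF.
rewrite Lnorm_scale//; last first.
  under eq_fun do rewrite big_nat.
  apply: (measurable_wrt_measurable (@subset_refl _ measurable)).
  apply: measurable_wrt_sum => [|i Di]; first exact: sigma_algebra_measurable.
  apply: measurable_wrtM; [exact: sigma_algebra_measurable| |].
    by apply: measurable_wrt_cst; exact: sigma_algebra_measurable.
  have [FS _ mth _ _] := thetaF.
  by apply: measurable_wrt_sub (mth i Di); have [] := FS i Di.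
rewrite gtr0_norm// big_ord_recl -/C mulrC EFinM lee_wpmul2l ?lee_fin ?(ltW sqS_gt0)//.
rewrite -mulrA.
apply: (Lnorm_reverse_martingale_differences_le thetaF _ Ntheta).
  exact: mulr_ge0.
under eq_bigr do rewrite expr_div_n !sqr_sqrtr//.
by rewrite -mulr_suml divff.
Qed.

End polynomial_inequality.

(** * The constant K_M and the norms in G *)

Section KM.
Context (R : realType).
Implicit Types (p K k : R).
Local Open Scope ereal_scope.

(** For the single difference [X] with weight 1, admissibility reads |X|_p <= K |X|_p, and a
    positive finite norm cancels. *)
Lemma KM_admissible_ge1 (disp : measure_display) (T : measurableType disp)
    (P : probability T R) (G : set (set T)) (X : T -> R) p K :
  sub_sigma_field G -> measurable_wrt G X -> centered P X ->
  0 < 'N[P]_(p%:E)[EFin \o X] < +oo -> KM_admissible p K -> (1 <= K)%R.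
Proof.
move=> GF mX cX /andP[X0 Xoo] /(_ _ _ P 1%N (fun=> G) (fun=> X) (fun=> 1%R)).
rewrite !big_ord1 expr1n => /(_ _ erefl).
rewrite (_ : (fun w => _) = X); last by apply/funext => w; rewrite big_ord1 mul1r.
move=> h; have {}h : 'N[P]_p%:E[EFin \o X] <=
    K%:E * nnsup [set 'N[P]_p%:E[EFin \o X] | _ in `I_1].
  by apply: h; split => // i j; case: i.
have nnsupE : nnsup [set 'N[P]_p%:E[EFin \o X] | _ in `I_1] = 'N[P]_p%:E[EFin \o X].
  apply/eqP; rewrite eq_le; apply/andP; split; last by apply: le_nnsup; exists 0%N.
  by apply: nnsup_le => [|_ [_ _ <-]]; first exact: Lnorm_ge0.
move: h; rewrite nnsupE; move: X0 Xoo.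
case: ('N[P]_p%:E[EFin \o X]) => // a; rewrite lte_fin => a0 _.
by rewrite -EFinM lee_fin ler_pMl.
Qed.

(** The infimum is attained: in each fixed instance the inequality [V <= K S] passes to the infimum
    over [K], after the values 0 and [+oo] of [S] are treated apart. *)
Lemma KM_admissible_KM p k : (0 < k)%R -> KM p = k%:E -> KM_admissible p k.
Proof.
move=> k0 KMk disp T P n F theta b mtheta b1.
have adm K (KK : KM_admissible p K) := KK _ _ _ _ _ _ _ mtheta b1.
set S := nnsup _ in adm *; set V := 'N[P]_(p%:E)[_] in adm *.
have V0 : 0 <= V by exact: Lnorm_ge0.
(* The infimum of the empty set is [+oo], so some constant is admissible; it settles the case
   [S = 0]. *)
have [K0 KK0] : exists K, KM_admissible p K.
  apply: contrapT => /forallNP nK; have : KM p = +oo.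
    by rewrite /KM -[RHS](@ereal_inf0 R); congr ereal_inf; apply/seteqP; split => // y [K /nK].
  by rewrite KMk.
have := nnsup_ge0 [set 'N[P]_p%:E[EFin \o theta i] | i in `I_n]; rewrite -/S.
move: adm; case: S => [s||] adm //; last by move=> _; rewrite gt0_muley ?lte_fin// leey.
rewrite lee_fin le_eqVlt => /predU1P[s0|s0].
  by have := adm _ KK0; rewrite -s0 !mule0.
rewrite -lee_pdivrMr// -KMk; apply: le_ereal_inf_tmp => _ [K KK <-].
by rewrite lee_pdivrMr//; exact: adm.
Qed.

Lemma zeta_EFin p k (I : Type) (s : seq I) (nu : I -> R -> \bar R) (c : I -> R) :
  KM p = k%:E -> (forall m, nu m p = (c m)%:E) ->
  zeta [seq nu m | m <- s] p = (\prod_(m <- s) (k * c m))%:E.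
Proof.
move=> KMk nuc; elim: s => [|m s IH] /=; first by rewrite big_nil.
by rewrite IH KMk nuc big_cons -!EFinM mulrAC.
Qed.

(** The list is nonempty, so a factor [KM p] occurs and positive factors preserve it; the empty list
    would give 1. *)
Lemma zeta_pinfty p (I : Type) m (s : seq I) (nu : I -> R -> \bar R) :
  KM p = +oo -> (forall m, 0 < nu m p) -> zeta [seq nu m | m <- m :: s] p = +oo.
Proof.
move=> KMy nu0; elim: s m => [|m' s IH] m /=; first by rewrite KMy mule1 gt0_mulye.
by have /= -> := IH m'; rewrite KMy mulyy gt0_mulye.
Qed.

End KM.

(** * Bounds at a fixed exponent, including N = oo *)

Section G_norm_bounds.
Context (R : realType) (disp : measure_display) (T : measurableType disp)
  (P : probability T R).
Local Open Scope ereal_scope.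

Lemma class_G_gt0_fin (r : \bar R) nu p : class_G r nu -> (2 < p)%R -> p%:E < r ->
  0 < nu p < +oo.
Proof.
move=> [_ _ nuD _ _] p2 pr; apply: nuD; split => //.
by apply/ltW/lt_trans/p2; rewrite ltr1n.
Qed.

(** One exponent suffices: there [sup_Lnorm] is the supremum of the numerators, positive and finite
    by [class_G], so the ratio is 1. *)
Lemma vector_G_norm_ge1 n N (r : \bar R) (x : nat -> T -> R) :
  class_G r (sup_Lnorm P n N x) ->
  1 <= vector_G_norm P n N r (sup_Lnorm P n N x) x.
Proof.
move=> Gr; have [r2 _ _ _ _] := Gr.
have [p p2 pr] : exists2 p : R, (2 < p)%R & p%:E < r.
  case: r r2 {Gr} => [r||//]; last by move=> _; exists 3%R; rewrite ?ltr_nat// ltry.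
  by rewrite lte_fin => r2; have [] := midf_lt r2; exists ((2 + r) / 2)%R.
have := class_G_gt0_fin Gr p2 pr.
case E : (sup_Lnorm P n N x p) => [c||]; rewrite ?ltxx ?andbF//= lte_fin ltry andbT => c0.
rewrite /vector_G_norm; apply: le_trans (le_nnsup _); last by exists p.
rewrite -(@lee_pmul2r _ c%:E) ?lte_fin// mul1e -{1}E.
apply: nnsup_le; first by rewrite mule_ge0 ?nnsup_ge0// lee_fin ltW.
move=> _ [i Di <-]; rewrite -lee_pdivrMr//.
by apply: le_nnsup; exists i => //; rewrite E inver gt_eqF.
Qed.

Lemma exists_sup_Lnorm_gt0 n N (x : nat -> T -> R) p :
  0 < sup_Lnorm P n N x p ->
  exists2 i, index_range n N i & 0 < 'N[P]_(p%:E)[EFin \o x i].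
Proof.
move=> s0; apply: contrapT => /forall2NP h; move: s0; rewrite ltNge => /negP; apply.
by apply: nnsup_le => // _ [i Di <-]; have [//|/negP] := h i; rewrite -leNgt.
Qed.

(** [N'] truncates the range. The truncated unit array has sum of squares at most 1, so the bound is
    uniform in [N'], as the passage to N = oo requires. *)
Lemma rpoly_fin_Lnorm_sup_le d n N N' F (xi : nat -> 'I_d -> T -> R) b p k
    (c : 'I_d -> R) :
  (1 <= p)%R -> (0 <= k)%R -> KM_admissible p k ->
  (forall m, reverse_martingale_differences P n N F (xi ^~ m)) ->
  independent_classes P (fun m => vector_sigma_algebra n N (xi ^~ m)) ->
  (forall m, sup_Lnorm P n N (xi ^~ m) p = (c m)%:E) ->
  unit_arrays n N b ->
  index_range n (Some N') `<=` index_range n N ->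
  'N[P]_(p%:E)[EFin \o rpoly_fin n N' xi b] <= (\prod_m (k * c m))%:E.
Proof.
move=> p1 k0 KMk rmd ind nuc b1 NN'.
have c0 m : (0 <= c m)%R by rewrite -lee_fin -nuc nnsup_ge0.
have kc0 : (0 <= \prod_m (k * c m))%R by apply: prodr_ge0 => m _; exact: mulr_ge0.
apply: le_trans.
  apply: (@rpoly_fin_Lnorm_le _ _ _ P p k p1 k0 KMk d n N' F xi b c) => //.
  - by move=> m; exact: reverse_martingale_differences_sub NN' (rmd m).
  - by apply: independent_classes_le ind => m; exact: vector_sigma_algebra_sub.
  - by move=> i m Di; rewrite -nuc; apply: le_nnsup; exists i => //; exact: NN'.
rewrite lee_fin ler_piMr// -sqrtr1 ler_sqrt// -lee_fin.
rewrite -fsumEFin; last exact: finite_multi_indices.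
rewrite -[leRHS]b1; apply: esum_ge.
exists (multi_indices d n (Some N')) => //; split; first exact: finite_multi_indices.
by move=> I [sI IN']; split => // m; exact: NN'.
Qed.

Lemma rpoly_Lnorm_sup_le d n N F (xi : nat -> 'I_d -> T -> R) b p k (c : 'I_d -> R) :
  (1 <= p)%R -> (0 <= k)%R -> KM_admissible p k ->
  (forall m, reverse_martingale_differences P n N F (xi ^~ m)) ->
  independent_classes P (fun m => vector_sigma_algebra n N (xi ^~ m)) ->
  (forall m, sup_Lnorm P n N (xi ^~ m) p = (c m)%:E) ->
  unit_arrays n N b -> rpoly_defined P n N xi b ->
  'N[P]_(p%:E)[EFin \o rpoly n N xi b] <= (\prod_m (k * c m))%:E.
Proof.
case: N => [N'|] p1 k0 KMk rmd ind nuc b1 cb.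
  exact: (rpoly_fin_Lnorm_sup_le p1 k0 KMk rmd ind nuc b1).
have c0 m : (0 <= c m)%R by rewrite -lee_fin -nuc nnsup_ge0.
apply: Lnorm_limn_le => //.
- exact: lt_le_trans p1.
- by apply: prodr_ge0 => m _; exact: mulr_ge0.
- move=> N'; apply: (measurable_wrt_measurable (@subset_refl _ measurable)).
  apply: measurable_wrt_rpoly_fin; first exact: sigma_algebra_measurable.
  move=> i m /andP[ni _]; have [FS _ mF _ _] := rmd m.
  have Di : index_range n None i by rewrite /index_range/= ni.
  by apply: measurable_wrt_sub (mF i Di); have [] := FS i Di.
- move=> N'; apply: (rpoly_fin_Lnorm_sup_le p1 k0 KMk rmd ind nuc b1).
  exact: index_range_sub.
Qed.

End G_norm_bounds.

(** * From fixed exponents to the norms in G *)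

Unset Implicit Arguments.
Set Strict Implicit.
Set Printing Implicit Defensive.

Theorem theorem7p4 (R : realType) (disp : measure_display)
    (T : measurableType disp) (P : probability T R)
    (d n : nat) (N : option nat)
    (F : nat -> set (set T)) (xi : nat -> 'I_d -> T -> R)
    (r : 'I_d -> \bar R)
    (d_ge1 : (1 <= d)%N) (n_ge1 : (1 <= n)%N)
    (n_le_N : if N is Some N' then (n <= N')%N else true)
    (xi_rmd : forall m : 'I_d,
       reverse_martingale_differences P n N F (fun i => xi i m))
    (xi_indep : independent_classes P
       (fun m : 'I_d => vector_sigma_algebra n N (fun i => xi i m)))
    (nu_G : forall m : 'I_d,
       class_G (r m) (sup_Lnorm P n N (fun i => xi i m))) :
  let nu (m : 'I_d) : R -> \bar R := sup_Lnorm P n N (fun i => xi i m) in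
  let zeta1 : R -> \bar R := zeta [seq nu m | m <- enum 'I_d] in
  let s : \bar R := \big[Order.min/+oo%E]_(m < d) r m in
  (nnsup [set G_norm P s zeta1 (rpoly n N xi b)
         | b in [set b | unit_arrays n N b /\ rpoly_defined P n N xi b]]
   <= \prod_(m < d) vector_G_norm P n N (r m) (nu m) (fun i => xi i m))%E.
Proof.
(* With the right-hand side at least 1, it remains to bound every quotient on the left by 1. *)
have RHS1 : (1 <= \prod_(m < d) vector_G_norm P n N (r m)
    (sup_Lnorm P n N (fun i => xi i m)) (fun i => xi i m))%E.
  apply: (big_ind (fun x => 1 <= x)%E) => // [x y x1 y1|m _].
    by rewrite -[1%E]mule1 lee_pmul.
  exact: vector_G_norm_ge1 (nu_G m).
cbv zeta; apply: le_trans RHS1.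
set nu := fun m : 'I_d => sup_Lnorm P n N (xi ^~ m).
set zeta1 := zeta _; set s := \big[_/_]_(m < d) r m.
apply: nnsup_le => // _ [b [b1 cb] <-].
apply: nnsup_le => // _ [p [p2 ps] <-].
have pr m : (p%:E < r m)%E by apply: lt_le_trans ps _; exact: bigmin_le.
have nup m : (0 < nu m p < +oo)%E by exact: class_G_gt0_fin (nu_G m) p2 (pr m).
pose c m := fine (nu m p).
have nuc m : nu m p = (c m)%:E.
  by have /andP[nu0 nuoo] := nup m; rewrite fineK// ge0_fin_numE// ltW.
have c0 m : 0 < c m by rewrite -lte_fin -nuc; have /andP[] := nup m.
have p1 : 1 <= p by apply/ltW/lt_trans/p2; rewrite ltr1n.
pose m0 : 'I_d := Ordinal d_ge1.
(* Positivity of [nu m0 p] provides a difference of positive finite norm to test admissible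
   constants on. The bound makes [KM p] positive, so a finite value is itself admissible. *)
have KM1 : (1 <= KM p)%E.
  apply: le_ereal_inf_tmp => _ [K KK <-]; rewrite lee_fin.
  have /andP[nu0 nuoo] := nup m0.
  have [i Di Ni] := exists_sup_Lnorm_gt0 nu0.
  have [FS _ mF cF _] := xi_rmd m0.
  apply: (KM_admissible_ge1 (FS i Di) (mF i Di) (cF i Di) _ KK).
  rewrite Ni/=; apply: le_lt_trans nuoo.
  by apply: le_nnsup; exists i.
case KMp : (KM p) KM1 => [k| |//] k1.
  rewrite lee_fin in k1.
  have k0 : 0 < k by exact: lt_le_trans k1.
  have z0 : 0 < \prod_m (k * c m) by apply: prodr_gt0 => m _; exact: mulr_gt0.
  rewrite /zeta1 (zeta_EFin _ KMp nuc) big_enum/=.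
  rewrite inver gt_eqF// lee_pdivrMr// mul1e.
  apply: (rpoly_Lnorm_sup_le p1 (ltW k0) _ xi_rmd xi_indep nuc b1 cb).
  exact: KM_admissible_KM.
(* Here [KM p] is infinite; [d_ge1] makes the list of factors nonempty. *)
have -> : zeta1 p = +oo%E.
  rewrite /zeta1; case E : (enum 'I_d) => [|m e].
    by have := mem_enum 'I_d m0; rewrite E.
  by apply: zeta_pinfty => // m'; have /andP[] := nup m'.
by rewrite invey mule0.
Qed.
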